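(* Let $d,s\in\mathbb{Z}_+$ with $s\le d/2$ and $\binom{d-s}{s}\ge 2$, let $\beta_{\min}>0$, $\sigma^2>0$, $0<\omega<1$ and $\delta\in(0,1/2)$. Let $\mathcal{M}$ be the class of Gaussian linear models $(\beta,\Sigma,\sigma^2)$ with $\beta\in\Theta_{d,s}(\beta_{\min})$ and $\Sigma\in\Omega_{d,s}(\omega)$. Suppose one observes $n$ i.i.d. samples from $P_{\beta,\Sigma,\sigma^2}$ with $(\beta,\Sigma,\sigma^2)\in\mathcal{M}$, where $$ n\ \le\ \frac{1-2\delta}{2}\times\max_{1\le \ell\le s}\frac{\log\binom{d-s}{\ell}}{\ell\,\beta_{\min}^2\,\omega/\sigma^2}\ \asymp\ \frac{1-2\delta}{2}\times\frac{\log(d-s)}{\beta_{\min}^2\,\omega/\sigma^2}, $$ where $\asymp$ denotes equality up to absolute multiplicative constants. Then $$ \inf_{\widehat S}\ \sup_{(\beta,\Sigma,\sigma^2)\in\mathcal{M}}\ \mathbb{P}_{\beta,\Sigma,\sigma^2}\big(\widehat S\ne S_*\big)\ \ge\ \delta-\frac{\log 2}{\log\binom{d-s}{s}}, $$ where $S_*=\operatorname{supp}(\beta)$ and the infimum is over all estimators $\widehat S$ of the support, i.e. all measurable functions of the $n$ samples with values in the subsets of $\{1,\dots,d\}$.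
   Context: Model: $P_{\beta,\Sigma,\sigma^2}$ is the law of $(X,Y)\in\mathbb{R}^d\times\mathbb{R}$ with $Y=X^\top\beta+\epsilon$, $X\sim\mathcal{N}(0,\Sigma)$, $\epsilon\sim\mathcal{N}(0,\sigma^2)$, $X$ independent of $\epsilon$. Let $\mathcal{S}_{d,s}=\{S\subseteq\{1,\dots,d\}:|S|=s\}$. For $\Sigma$ positive definite and index sets $S,T$, $\Sigma_{ST}$ is the submatrix with rows $S$ and columns $T$, and $\Sigma_{S\setminus T\mid T}=\Sigma_{(S\setminus T)(S\setminus T)}-\Sigma_{(S\setminus T)T}\Sigma_{TT}^{-1}\Sigma_{T(S\setminus T)}$ is the conditional covariance. $\Theta_{d,s}(\beta_{\min})=\{\beta\in\mathbb{R}^d:\ \|\beta\|_0=s,\ \min_{j\in\operatorname{supp}(\beta)}|\beta_j|\ge\beta_{\min}\}$, where $\|\beta\|_0=|\operatorname{supp}(\beta)|$ is the number of nonzero entries. $\Omega_{d,s}(\omega)$ is the set of $d\times d$ positive definite matrices $\Sigma$ with $\lambda_{\min}(\Sigma_{S\setminus T\mid T})\ge\omega$ for all distinct $S,T\in\mathcal{S}_{d,s}$. The parameters $d,s,\beta_{\min},\omega,\sigma^2$ defining $\mathcal{M}$ are fixed. *)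

(* Defs.v *)
From HB Require Import structures.
From mathcomp Require Import all_boot all_order all_algebra.
From mathcomp Require Import ring.
From mathcomp Require Import all_classical all_reals all_analysis.
From mathcomp Require Import measurable_realfun.

Set Implicit Arguments.
Unset Strict Implicit.
Unset Printing Implicit Defensive.

Import Order.TTheory GRing.Theory Num.Theory.

Local Open Scope classical_set_scope.
Local Open Scope ring_scope.

Section matrices.
Context {R : realType}.

Definition posdef n (A : 'M[R]_n) : Prop :=
  A^T = A /\ forall x : 'cV[R]_n, x != 0 -> 0 < (x^T *m A *m x) 0 0.

(* On the symmetric matrices of positive size to which it is applied, the set
   of (real) eigenvalues is nonempty and finite, so that inf is a minimum. *)
Definition lambda_min n (A : 'M[R]_n) : R := inf [set a | eigenvalue A a].

Definition submx d (S T : {set 'I_d}) (Sigma : 'M[R]_d) : 'M[R]_(#|S|, #|T|) :=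
  mxsub enum_val enum_val Sigma.

Definition cond_cov d (Sigma : 'M[R]_d) (S T : {set 'I_d}) :
    'M[R]_#|(S :\: T)%SET| :=
  let U := (S :\: T)%SET in
  submx U U Sigma
    - submx U T Sigma *m invmx (submx T T Sigma) *m submx T U Sigma.

(* The lower triangular Cholesky factor: if A has blocks a, v^T, v, D with
   a : R, then the first column of the factor is (sqrt a, v / sqrt a) and the
   remaining block is the factor of the Schur complement D - v v^T / a. *)
Fixpoint cholesky n : 'M[R]_n -> 'M[R]_n :=
  match n with
  | 0 => fun _ => 0
  | n'.+1 => fun A : 'M[R]_(1 + n') =>
      let r := Num.sqrt (A 0 0) in
      let v := r^-1 *: dlsubmx A in
      block_mx r%:M 0 v (cholesky (drsubmx A - v *m v^T))
  end.

Lemma choleskyK n (A : 'M[R]_n) :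
  posdef A -> cholesky A *m (cholesky A)^T = A.
Proof.
elim: n A => [A _|n IHn A]; first by rewrite [LHS]flatmx0 [RHS]flatmx0.
rewrite -[n.+1]/(1 + n)%N in A * => -[symA posA].
set a : R := A 0 0; set v : 'cV[R]_n := dlsubmx A; set D := drsubmx A.
have ulA : ulsubmx A = a%:M.
  by rewrite [LHS]mx11_scalar !mxE /a; congr (A _ _)%:M; apply/val_inj.
have urA : ursubmx A = v^T by rewrite /v -[in RHS]symA -trmx_ursub trmxK.
have defA : A = block_mx a%:M v^T v D by rewrite -ulA -urA submxK.
have symD : D^T = D by rewrite /D trmx_drsub symA.
have quadA (t : R) (x : 'cV[R]_n) :
    ((col_mx t%:M x)^T *m A *m col_mx t%:M x) 0 0 =
    t * a * t + (x^T *m v) 0 0 * t + t * (v^T *m x) 0 0 + (x^T *m D *m x) 0 0.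
  rewrite defA tr_col_mx mul_row_block mul_row_col tr_scalar_mx.
  rewrite !mulmxDl -!scalar_mxM !mul_scalar_mx.
  rewrite mul_mx_scalar -scalemxAl addrA.
  by do ![rewrite [LHS]mxE; congr (_ + _)]; rewrite [LHS]mxE // mulrC.
have a_gt0 : 0 < a.
  have := posA (col_mx 1%:M 0); rewrite quadA trmx0 !mul0mx mulmx0 !mxE.
  rewrite !(mul1r, mulr1, mul0r, mulr0, addr0); apply.
  by rewrite col_mx_eq0 negb_and oner_eq0.
have r0 : Num.sqrt a != 0 by rewrite gt_eqF ?sqrtr_gt0.
have rr : Num.sqrt a * Num.sqrt a = a by rewrite -expr2 sqr_sqrtr ?ltW.
have vv : ((Num.sqrt a)^-1 *: v) *m ((Num.sqrt a)^-1 *: v)^T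
    = a^-1 *: (v *m v^T).
  by rewrite linearZ -scalemxAl -scalemxAr scalerA -invfM rr.
have {}IHn := IHn (D - a^-1 *: (v *m v^T)).
rewrite [cholesky A]/= -/a -/v -/D vv tr_block_mx mulmx_block !trmx0.
rewrite tr_scalar_mx !mulmx0 !mul0mx !addr0 -scalar_mxM rr IHn; last first.
  split=> [|x x0]; first by rewrite !linearB /= linearZ /= trmx_mul trmxK symD.
  pose c := (x^T *m v) 0 0.
  have vx : (v^T *m x) 0 0 = c by rewrite -[v^T *m x]trmxK trmx_mul trmxK mxE.
  have := posA (col_mx (- (c / a))%:M x); rewrite quadA vx -/c.
  have -> : (x^T *m (D - a^-1 *: (v *m v^T)) *m x) 0 0 =
      (x^T *m D *m x) 0 0 - a^-1 * (c * c).
    rewrite mulmxBr mulmxBl mxE [X in _ + X]mxE; congr (_ - _).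
    rewrite -scalemxAr -scalemxAl mxE; congr (_ * _).
    by rewrite mulmxA -[_ *m v^T *m x]mulmxA mxE big_ord1 vx.
  suff -> : - (c / a) * a * - (c / a) + c * - (c / a) + - (c / a) * c +
      (x^T *m D *m x) 0 0 = (x^T *m D *m x) 0 0 - a^-1 * (c * c).
    by apply; rewrite col_mx_eq0 negb_and x0 orbT.
  by field; rewrite gt_eqF.
rewrite vv addrC subrK [RHS]defA; congr block_mx.
  by rewrite mul_scalar_mx linearZ scalerA divff ?scale1r.
by rewrite mul_mx_scalar scalerA divff ?scale1r.
Qed.

End matrices.

Section iid.
Context d {T : measurableType d} {R : realType}.

Definition tcons n (x : T * n.-tuple T) : n.+1.-tuple T := [tuple of x.1 :: x.2].

Lemma measurable_tcons n : measurable_fun setT (@tcons n).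
Proof. exact: measurable_cons. Qed.

HB.instance Definition _ n :=
  isMeasurableFun.Build _ _ _ _ (@tcons n) (@measurable_tcons n).

Fixpoint iid_law (P : probability T R) n : probability (n.-tuple T) R :=
  match n with
  | 0 => \d_([tuple] : 0.-tuple T)
  | n'.+1 => distribution (P \x iid_law P n')%E (@tcons n')
  end.

Lemma iid_law_box (P : probability T R) n (A : 'I_n -> set T) :
  (forall i, measurable (A i)) ->
  iid_law P n [set x | forall i, A i (tnth x i)] = (\prod_(i < n) P (A i))%E.
Proof.
elim: n A => [A _|n IHn A mA] /=.
  by rewrite big_ord0 diracE mem_set// => -[].
rewrite /distribution /pushforward.
rewrite (_ : _ @^-1` _ =
  A ord0 `*` [set x | forall i, A (lift ord0 i) (tnth x i)]); last first.
  apply/seteqP; split => [[x y] /= H|[x y] /= [Hx Hy] i].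
    by split=> [|i]; [have := H ord0|have := H (lift ord0 i)]; rewrite ?tnthS.
  by have [j ->|->//] := unliftP ord0 i; rewrite tnthS.
rewrite product_measure1E//=.
  by rewrite big_ord_recl; congr (_ * _)%E; apply: IHn.
rewrite (_ : [set x | _] = \bigcap_(i in [set: 'I_n])
   ((@tnth n T)^~ i @^-1` A (lift ord0 i))); last first.
  by apply/seteqP; split => x /= H i; [move=> _|]; apply: H.
apply: fin_bigcap_measurable => // i _.
by rewrite -[X in measurable X]setTI; apply: measurable_tnth.
Qed.

End iid.

Section linear_model.
Context {R : realType}.
Local Notation RR := (measurableTypeR R).

Definition vec_of_tuple d (x : d.-tuple RR) : 'cV[R]_d := \col_j tnth x j.

Definition mulmx_tuple d (A : 'M[R]_d) (z : d.-tuple RR) : d.-tuple RR :=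
  [tuple (A *m vec_of_tuple z) i 0 | i < d].

Lemma measurable_mulmx_tuple d (A : 'M[R]_d) :
  measurable_fun setT (mulmx_tuple A).
Proof.
apply/measurable_fun_tnthP => i.
rewrite (_ : _ \o _ = fun z => \sum_(j < d) A i j * tnth z j); last first.
  apply/funext => z /=; rewrite tnth_mktuple mxE.
  by apply: eq_bigr => j _; rewrite mxE.
apply: measurable_sum => j; apply: measurable_funM => //.
exact: measurable_tnth.
Qed.

HB.instance Definition _ d (A : 'M[R]_d) :=
  isMeasurableFun.Build _ _ _ _ (mulmx_tuple A) (measurable_mulmx_tuple A).

(* N(0, Sigma) is the law of L Z where Z is a standard Gaussian vector and
   L L^T = Sigma (any such L gives the same law); see choleskyK. *)
Definition gaussian d (Sigma : 'M[R]_d) : probability (d.-tuple RR) R :=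
  distribution (iid_law (normal_prob (0 : R) 1) d) (mulmx_tuple (cholesky Sigma)).

Definition response d (beta : 'cV[R]_d) (xe : d.-tuple RR * RR) :
    d.-tuple RR * RR :=
  (xe.1, ((vec_of_tuple xe.1)^T *m beta) 0 0 + xe.2).

Lemma measurable_response d (beta : 'cV[R]_d) :
  measurable_fun setT (response beta).
Proof.
apply/measurable_fun_pair => //=; apply: measurable_funD => //.
rewrite (_ : (fun _ => _) =
    (fun x : d.-tuple RR => \sum_(j < d) tnth x j * beta j 0) \o fst).
  apply: measurableT_comp => //; apply: measurable_sum => j.
  by apply: measurable_funM => //; exact: measurable_tnth.
by apply/funext => x /=; rewrite mxE; apply: eq_bigr => j _; rewrite !mxE.
Qed.

HB.instance Definition _ d (beta : 'cV[R]_d) :=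
  isMeasurableFun.Build _ _ _ _ (response beta) (measurable_response beta).

(* normal_prob takes the standard deviation, not the variance. *)
Definition linear_model_law d (beta : 'cV[R]_d) (Sigma : 'M[R]_d) (sigma2 : R) :
    probability (d.-tuple RR * RR)%type R :=
  distribution (gaussian Sigma \x normal_prob (0 : R) (Num.sqrt sigma2))%E
    (response beta).

Definition supp d (beta : 'cV[R]_d) : {set 'I_d} :=
  [set j | beta j 0 != 0]%SET.

Definition Theta d s (beta_min : R) : set 'cV[R]_d :=
  [set beta | #|supp beta| = s /\
     forall j, j \in supp beta -> beta_min <= `|beta j 0|].

Definition Omega d s (omega : R) : set 'M[R]_d :=
  [set Sigma | posdef Sigma /\
     forall S T : {set 'I_d}, #|S| = s -> #|T| = s -> S != T ->
       omega <= lambda_min (cond_cov Sigma S T)].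

(* A model is a triple (beta, Sigma, sigma^2). *)
Definition model d : Type := 'cV[R]_d * 'M[R]_d * R.

Definition model_class d s (beta_min omega sigma2 : R) : set (model d) :=
  [set m | [/\ Theta s beta_min m.1.1, Omega s omega m.1.2 & m.2 = sigma2]].

Definition samples n d : Type := n.-tuple (d.-tuple RR * RR).

(* Measurability for the discrete sigma-algebra on the sets of indices. *)
Definition estimator n d : set (samples n d -> {set 'I_d}) :=
  [set Shat | forall B : set {set 'I_d},
     measurable (Shat @^-1` B : set (n.-tuple (d.-tuple RR * RR)))].

Definition error_prob n d (Shat : samples n d -> {set 'I_d})
    (m : model d) : \bar R :=
  iid_law (linear_model_law m.1.1 m.1.2 m.2) n
    [set z | Shat z != supp m.1.1].

Definition minimax_risk n d (M : set (model d)) : \bar R :=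
  ereal_inf [set ereal_sup [set error_prob Shat m | m in M]
            | Shat in @estimator n d].

(* The terms are nonnegative when beta_min, omega, sigma2 > 0 and s <= d - s,
   so that the initial value 0 does not affect the maximum. *)
Definition max_term d s (beta_min omega sigma2 : R) : R :=
  \big[Num.max/0]_(1 <= l < s.+1)
    (ln ('C(d - s, l)%:R) / (l%:R * beta_min ^+ 2 * omega / sigma2)).

End linear_model.

(* Main.v *)
(** Since [C(m, l) <= m ^ l], the maximum over [l] is attained at [l = 1], so the
    two rates coincide and it suffices to vary a single coordinate. Take
    [Sigma = omega I] and the [d - s + 1] signals that equal [beta_min] on [s - 1]
    fixed coordinates and on one further coordinate. Each of the resulting laws is
    within relative entropy [n beta_min^2 omega / sigma^2] of the law of the signal
    supported on the fixed coordinates only, and Fano's inequality bounds the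
    average probability of recovering the support. Relative entropies are handled
    in their variational (Donsker-Varadhan) form, which only involves integrals of
    bounded functions. *)

Require Import Defs.
From HB Require Import structures.
From mathcomp Require Import all_boot all_order all_algebra.
From mathcomp Require Import ring lra zify.
From mathcomp Require Import all_classical all_reals all_analysis.
From mathcomp Require Import measurable_realfun.

Set Implicit Arguments.
Unset Strict Implicit.
Unset Printing Implicit Defensive.

Import Order.TTheory GRing.Theory Num.Theory.
Local Open Scope classical_set_scope.
Local Open Scope ring_scope.

(** * Integrals against normal laws *)

Section normal_integrals.
Context {R : realType}.
Local Notation RR := (measurableTypeR R).
Local Notation mu := (@lebesgue_measure R).
Local Open Scope ereal_scope.

(** The change of variables formula uses the Radon-Nikodym derivative of [normal_prob]. It agrees
    almost everywhere with [normal_pdf], since both have the same integral over every measurable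
    set. *)
Lemma ge0_integral_normal_prob (m s : R) (f : R -> \bar R) :
  measurable_fun setT f -> (forall x, 0 <= f x) ->
  \int[normal_prob m s]_x f x = \int[mu]_x (f x * (normal_pdf m s x)%:E).
Proof.
move=> mf f0; have dom := normal_prob_dominates m s.
rewrite -(Radon_Nikodym_SigmaFinite.change_of_variables dom)//.
have mg := measurable_int _ (Radon_Nikodym_SigmaFinite.f_integrable dom).
have mpdf : measurable_fun setT (fun x : R => (normal_pdf m s x)%:E).
  by apply/measurable_EFinP; exact: measurable_normal_pdf.
apply: ae_eq_integral => //; [exact: emeasurable_funM|exact: emeasurable_funM|].
apply: ae_eqe_mul2l; apply: integral_ae_eq => //.
  exact: Radon_Nikodym_SigmaFinite.f_integrable.
by move=> E _ mE; rewrite -Radon_Nikodym_SigmaFinite.f_integral.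
Qed.

Lemma measurable_subl (a : R) :
  measurable_fun setT (fun x : RR => (a - x)%R : RR).
Proof. by apply: measurable_funB. Qed.

(** By uniqueness of Lebesgue measure it suffices to compare on the intervals []x, y]], whose
    preimages [[a - y, a - x[] have the same length. *)
Lemma lebesgue_measure_subl (a : R) (A : set R) : measurable A ->
  pushforward mu (fun x : RR => (a - x)%R : RR) A = mu A.
Proof.
move=> mA; pose f := HB.pack_for {mfun RR >-> RR} (fun x : RR => (a - x)%R : RR)
  (isMeasurableFun.Build _ _ _ _ _ (measurable_subl a)).
apply/esym/(@lebesgue_measure_unique _ (pushforward mu f)) => //= _ [[x y]] _ <-.
rewrite /pushforward /=.
rewrite (_ : _ @^-1` _ = `[(a - y)%R, (a - x)%R[%classic); last first.
  by apply/seteqP; split => z /=; rewrite !in_itv/= => /andP[? ?]; apply/andP; split; lra.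
rewrite !lebesgue_measure_itv/= !lte_fin ltrD2l ltrN2.
by case: ifP => // _; rewrite -!EFinB; congr _%:E; lra.
Qed.

Lemma ge0_integral_subl (a : R) (f : R -> \bar R) :
  measurable_fun setT f -> (forall x, 0 <= f x) ->
  \int[mu]_x f (a - x)%R = \int[mu]_x f x.
Proof.
move=> mf f0; pose phi := HB.pack_for {mfun RR >-> RR} (fun x : RR => (a - x)%R : RR)
  (isMeasurableFun.Build _ _ _ _ _ (measurable_subl a)).
transitivity (\int[pushforward mu phi]_x f x).
  by rewrite ge0_integral_pushforward.
by apply: eq_measure_integral => A mA _; exact: lebesgue_measure_subl.
Qed.

Section centered.
Variables (s : R) (s0 : s != 0%R).

Lemma normal_pdf_subl (a x : R) :
  (normal_pdf 0 s (a - x) =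
    expR (- (a ^+ 2 - 2 * a * x) / (s ^+ 2 *+ 2)) * normal_pdf 0 s x)%R.
Proof.
rewrite !(normal_pdfE _ s0) /normal_fun mulrCA -expRD; congr (_ * expR _)%R.
by field.
Qed.

(** The exponential is the ratio of the densities at [a - x] and at [x], so this reduces to the
    invariance of Lebesgue measure under a reflection. Reflections serve twice: [a = 0] gives the
    symmetry of the law, and composing with that symmetry gives the formula for translations. *)
Lemma ge0_integral_normal_subl (a : R) (f : R -> \bar R) :
  measurable_fun setT f -> (forall x, 0 <= f x) ->
  \int[normal_prob 0 s]_x
    (f (a - x)%R * (expR (- (a ^+ 2 - 2 * a * x) / (s ^+ 2 *+ 2)))%:E) =
  \int[normal_prob 0 s]_x f x.
Proof.
move=> mf f0; have mf' : measurable_fun setT (fun x : R => f (a - x)%R).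
  by apply: (measurableT_comp mf); exact: measurable_subl.
rewrite !ge0_integral_normal_prob//; last 2 first.
  apply: emeasurable_funM => //; apply/measurable_EFinP.
  apply: measurableT_comp => //; apply: measurable_funM => //.
  by apply: measurableT_comp => //; apply: measurable_funB => //; exact: measurable_funM.
  by move=> x; rewrite mule_ge0// lee_fin expR_ge0.
rewrite -[RHS](ge0_integral_subl a); last 2 first.
- by apply: emeasurable_funM => //; by apply/measurable_EFinP; exact: measurable_normal_pdf.
- by move=> x; rewrite mule_ge0// lee_fin normal_pdf_ge0.
by apply: eq_integral => x _; rewrite normal_pdf_subl EFinM muleA.
Qed.

Lemma ge0_integral_normal_opp (f : R -> \bar R) :
  measurable_fun setT f -> (forall x, 0 <= f x) ->
  \int[normal_prob 0 s]_x f (- x)%R = \int[normal_prob 0 s]_x f x.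
Proof.
move=> mf f0; rewrite -[RHS](ge0_integral_normal_subl 0)//.
by apply: eq_integral => x _; rewrite sub0r expr0n mulr0 mul0r subrr oppr0 mul0r expR0 mule1.
Qed.

Lemma ge0_integral_normal_addl (a : R) (f : R -> \bar R) :
  measurable_fun setT f -> (forall x, 0 <= f x) ->
  \int[normal_prob 0 s]_x
    (f (a + x)%R * (expR (- (a ^+ 2 + 2 * a * x) / (s ^+ 2 *+ 2)))%:E) =
  \int[normal_prob 0 s]_x f x.
Proof.
move=> mf f0; set h := fun x : R => f (a - x)%R *
  (expR (- (a ^+ 2 - 2 * a * x) / (s ^+ 2 *+ 2)))%:E.
have mh : measurable_fun setT h.
  apply: emeasurable_funM.
    by apply: (measurableT_comp mf); exact: measurable_subl.
  apply/measurable_EFinP/measurableT_comp => //; apply: measurable_funM => //.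
  by apply: measurableT_comp => //; apply: measurable_funB => //; exact: measurable_funM.
have h0 x : 0 <= h x by rewrite mule_ge0// lee_fin expR_ge0.
transitivity (\int[normal_prob 0 s]_x h (- x)%R).
  by apply: eq_integral => x _; rewrite /h opprK mulrN opprK.
rewrite (ge0_integral_normal_opp mh h0); exact: ge0_integral_normal_subl.
Qed.

End centered.

(* [x^2 <= 4 (exp (x^2/4) - 1)], and [exp (x^2/4)] turns the N(0,1) density
   into [sqrt 2] times the N(0,2) density. *)
Lemma normal_second_moment_le2 :
  \int[normal_prob (0 : R) 1]_x (x ^+ 2)%:E <= 2%:E.
Proof.
have s2 : (Num.sqrt 2 != 0 :> R)%R by rewrite gt_eqF// sqrtr_gt0.
have mX : measurable_fun setT (fun x : R => (x ^+ 2)%:E).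
  by apply/measurable_EFinP; exact: measurable_funX.
have mE : measurable_fun setT (fun x : R => (expR (x ^+ 2 / 4))%:E).
  apply/measurable_EFinP; apply: measurableT_comp => //; apply: measurable_funM => //.
have key : \int[normal_prob (0 : R) 1]_x (expR (x ^+ 2 / 4))%:E = (Num.sqrt 2)%:E.
  rewrite ge0_integral_normal_prob//.
  transitivity (\int[mu]_x ((Num.sqrt 2)%:E * (normal_pdf 0 (Num.sqrt 2) x)%:E)).
    apply: eq_integral => x _; rewrite -!EFinM; congr EFin.
    rewrite (normal_pdfE _ (oner_neq0 R)) (normal_pdfE _ s2).
    rewrite /normal_peak /normal_fun subr0 sqr_sqrtr// expr1n mul1r mulrCA -expRD.
    rewrite mulrA; congr (_ * expR _)%R; last by field.
    rewrite -mulrnAr sqrtrM// invfM mulrA divff// mul1r //.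
  rewrite ge0_integralZl_EFin//.
  + by rewrite integral_normal_pdf mule1.
  + by move=> x _; rewrite lee_fin normal_pdf_ge0.
  + by apply/measurable_EFinP; exact: measurable_normal_pdf.
have : \int[normal_prob (0 : R) 1]_x ((x ^+ 2)%:E + 4%:E) <=
       \int[normal_prob (0 : R) 1]_x (4%:E * (expR (x ^+ 2 / 4))%:E).
  apply: ge0_le_integral => //=.
  - by move=> x _; rewrite -EFinD lee_fin addr_ge0// sqr_ge0.
  - exact: emeasurable_funD.
  - exact: emeasurable_funM.
  - move=> x _; rewrite -EFinD -EFinM lee_fin.
    by have := expR_ge1Dx (x ^+ 2 / 4); lra.
rewrite ge0_integralD//; last by move=> x _; rewrite lee_fin sqr_ge0.
rewrite ge0_integralZl_EFin//.
rewrite key integral_cst//= probability_setT mule1 -EFinM.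
rewrite -leeBrDr// => /le_trans; apply; rewrite -EFinB lee_fin.
(* What remains is [4 * sqrt 2 - 4 <= 2], that is [sqrt 2 <= 3 / 2]. *)
have := sqr_sqrtr (ler0n R 2); have := sqrtr_ge0 (2 : R); nra.
Qed.

End normal_integrals.

(** * Relative entropy in variational form, chain rule and tensorization *)

Section kullback_leibler.
Local Open Scope ereal_scope.

(** For measurable [g] with values in [[0, K]] the integral lies in [[1, exp K]], so that neither
    [fine] nor [ln] meets a default value. *)
Definition log_mgf {R : realType} d (T : measurableType d)
    (P : probability T R) (g : T -> R) : R :=
  ln (fine (\int[P]_x (expR (g x))%:E)).

(* Donsker-Varadhan form of [KL (P || Q) <= k]; testing against bounded
   nonnegative functions suffices, and no density of P is needed. *)
Definition kl_le {R : realType} d (T : measurableType d)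
    (P Q : probability T R) (k : R) :=
  forall (g : T -> R) K, measurable_fun setT g -> (forall x, 0 <= g x <= K)%R ->
    \int[P]_x (g x)%:E <= (k + log_mgf Q g)%:E.

Context {R : realType}.

Section log_mgf.
Context d (T : measurableType d) (P : probability T R) (g : T -> R) (K : R).
Hypotheses (mg : measurable_fun setT g) (g_bd : forall x, (0 <= g x <= K)%R).

Let mexp : measurable_fun setT (fun x => (expR (g x))%:E).
Proof. by apply/measurable_EFinP; exact: measurableT_comp. Qed.

Let mgf_ge1 : 1 <= \int[P]_x (expR (g x))%:E.
Proof.
have <- : \int[P]_x (cst 1 x) = 1.
  by rewrite integral_cst//= probability_setT mule1.
apply: ge0_le_integral => //= x _; rewrite lee_fin.
by rewrite -expR0 ler_expR; case/andP: (g_bd x).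
Qed.

Let mgf_le : \int[P]_x (expR (g x))%:E <= (expR K)%:E.
Proof.
have <- : \int[P]_x (cst (expR K)%:E x) = (expR K)%:E.
  by rewrite integral_cst//= probability_setT mule1.
apply: ge0_le_integral => //= x _; rewrite lee_fin ?expR_ge0//.
by rewrite ler_expR; case/andP: (g_bd x).
Qed.

Let mgf_fin : \int[P]_x (expR (g x))%:E \is a fin_num.
Proof.
rewrite ge0_fin_numE; last by apply: le_trans mgf_ge1.
by apply: le_lt_trans mgf_le _; rewrite ltry.
Qed.

Lemma integral_expR_log_mgf :
  \int[P]_x (expR (g x))%:E = (expR (log_mgf P g))%:E.
Proof.
rewrite /log_mgf lnK ?fineK// posrE (@lt_le_trans _ _ 1%R)//.
by rewrite -lee_fin fineK.
Qed.

Lemma log_mgf_itv : (0 <= log_mgf P g <= K)%R.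
Proof.
by apply/andP; split; rewrite -ler_expR ?expR0 -lee_fin -integral_expR_log_mgf.
Qed.

End log_mgf.

(** This is Jensen's inequality for the exponential, obtained by integrating [1 + u <= exp u] at
    [u = g x - c]; the terms are arranged so that both integrands are nonnegative. *)
Lemma kl_le_refl d (T : measurableType d) (P : probability T R) : kl_le P P 0%R.
Proof.
move=> g K mg g_bd; set c := log_mgf P g; rewrite add0r.
have /andP[c0 _] : (0 <= c <= K)%R by exact: log_mgf_itv.
have mE : measurable_fun setT (fun x => (expR (g x))%:E).
  by apply/measurable_EFinP; exact: measurableT_comp.
have : \int[P]_x ((g x)%:E + 1) <=
       \int[P]_x ((expR (- c))%:E * (expR (g x))%:E + c%:E).
  apply: ge0_le_integral => //=.
  - by move=> x _; rewrite adde_ge0// lee_fin; case/andP: (g_bd x).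
  - by apply: emeasurable_funD => //; exact/measurable_EFinP.
  - by apply: emeasurable_funD => //; exact: emeasurable_funM.
  - move=> x _; rewrite -EFinM -!EFinD lee_fin -expRD.
    by have := expR_ge1Dx (- c + g x); lra.
rewrite ge0_integralD//; last 2 first.
- by move=> x _; rewrite lee_fin; case/andP: (g_bd x).
- exact/measurable_EFinP.
rewrite ge0_integralD//; last exact: emeasurable_funM.
rewrite ge0_integralZl_EFin//.
rewrite (integral_expR_log_mgf P mg g_bd) -/c -EFinM -expRD addNr expR0.
rewrite !integral_cst//= !probability_setT !mule1.
by rewrite [X in _ <= X -> _]addeC leeD2rE.
Qed.

Lemma kl_le_ge0 d (T : measurableType d) (P Q : probability T R) (k : R) :
  kl_le P Q k -> (0 <= k)%R.
Proof.
move=> klPQ; have := klPQ (cst 0%R) 0%R (@measurable_cst _ _ _ _ _ _).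
have -> : log_mgf Q (cst 0%R) = 0%R.
  rewrite /log_mgf [X in fine X](_ : _ = \int[Q]_x (cst 1 x)).
    by rewrite integral_cst//= probability_setT mule1 ln1.
  by apply: eq_integral => x _; rewrite /= expR0.
rewrite integral0 addr0 lee_fin; by apply => x; rewrite lexx.
Qed.

(* The chain rule for the relative entropy, with [k x] a bound on the divergence
   of the conditional laws given the first component [x]. *)
Lemma kl_le_chain d1 d2 d3 (T1 : measurableType d1) (T2 : measurableType d2)
    (U : measurableType d3) (P1 Q1 : probability T1 R) (P2 Q2 : probability T2 R)
    (phi psi : {mfun (T1 * T2)%type >-> U}) (k1 kappa : R) (k : T1 -> R) :
  kl_le P1 Q1 k1 ->
  measurable_fun setT k -> (forall x, 0 <= k x)%R ->
  \int[P1]_x (k x)%:E <= kappa%:E ->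
  (forall x (g : U -> R) K, measurable_fun setT g -> (forall u, 0 <= g u <= K)%R ->
    \int[P2]_y (g (phi (x, y)))%:E <=
      (k x + log_mgf Q2 (fun y => g (psi (x, y))))%:E) ->
  kl_le (distribution (P1 \x P2) phi) (distribution (Q1 \x Q2) psi) (k1 + kappa)%R.
Proof.
move=> kl1 mk k0 kint kl2 g K mg g_bd.
have mgpsi : measurable_fun setT (g \o psi) by exact: measurableT_comp.
have mexp : measurable_fun setT (fun u => (expR (g u))%:E).
  by apply/measurable_EFinP; exact: measurableT_comp.
have mexpsi : measurable_fun setT (fun z => (expR (g (psi z)))%:E).
  by apply: (measurableT_comp mexp).
have bd x y : (0 <= g (psi (x, y)) <= K)%R by [].
have mgx x : measurable_fun setT (fun y => g (psi (x, y))).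
  by apply: (measurableT_comp mgpsi); exact: measurable_pair1.
(* Integrating out the second component turns [g] into a test function [h] of the first one, again
   with values in [[0, K]]. Since [exp h] is the conditional moment generating function,
   [log_mgf Q1 h] is the joint [log_mgf] of [g]. *)
pose h x := log_mgf Q2 (fun y => g (psi (x, y))).
have h_bd x : (0 <= h x <= K)%R by exact: log_mgf_itv.
have hE x : \int[Q2]_y (expR (g (psi (x, y))))%:E = (expR (h x))%:E.
  exact: integral_expR_log_mgf.
have mh : measurable_fun setT h.
  apply: measurableT_comp; first exact: measurable_ln.
  apply: measurableT_comp; first exact: fine_measurable.
  exact: (measurable_fun_fubini_tonelli_F (fun z => (expR (g (psi z)))%:E)).
rewrite ge0_integral_distribution//; last 2 first.
- exact/measurable_EFinP.
- by move=> u; rewrite lee_fin; case/andP: (g_bd u).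
rewrite fubini_tonelli1; last 2 first.
- by apply/measurable_EFinP; exact: measurableT_comp.
- by move=> z /=; rewrite lee_fin; case/andP: (g_bd (phi z)).
have -> : log_mgf (distribution (Q1 \x Q2) psi) g = log_mgf Q1 h.
  rewrite /log_mgf ge0_integral_distribution//.
  rewrite (fubini_tonelli1 (fun z => (expR (g (psi z)))%:E))//.
  by congr (ln (fine _)); apply: eq_integral => x _; exact: hE.
apply: (@le_trans _ _ (\int[P1]_x ((k x)%:E + (h x)%:E))).
  apply: ge0_le_integral => //=.
  - move=> x _; apply: integral_ge0 => y _; rewrite lee_fin.
    by case/andP: (g_bd (phi (x, y))).
  - apply: (measurable_fun_fubini_tonelli_F (fun z => (g (phi z))%:E)).
      by apply/measurable_EFinP; exact: measurableT_comp.
    by move=> z; rewrite lee_fin; case/andP: (g_bd (phi z)).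
  - by apply: emeasurable_funD; exact/measurable_EFinP.
  - by move=> x _; exact: kl2.
rewrite ge0_integralD//; first last.
- exact/measurable_EFinP.
- by move=> x _; rewrite lee_fin; case/andP: (h_bd x).
- exact/measurable_EFinP.
- by move=> x _; rewrite lee_fin.
have -> : (k1 + kappa + log_mgf Q1 h = kappa + (k1 + log_mgf Q1 h))%R by ring.
by rewrite EFinD leeD//; exact: kl1 mh h_bd.
Qed.

(** The samples are peeled off one at a time. By independence the remaining ones have the same law
    whatever the first sample is, so the conditional bound in the chain rule is a constant. *)
Lemma kl_le_iid d (T : measurableType d) (P Q : probability T R) (k : R) n :
  kl_le P Q k -> kl_le (iid_law P n) (iid_law Q n) (n%:R * k)%R.
Proof.
move=> klPQ; elim: n => [|n IHn]; first by rewrite mul0r; exact: kl_le_refl.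
rewrite mulrSr mulrDl mul1r addrC.
apply: (@kl_le_chain _ _ _ _ _ _ _ _ _ _ _ _ _ _ (cst (n%:R * k)%R)) => //.
- by move=> x; exact: kl_le_ge0 IHn.
- rewrite [leLHS](_ : _ = \int[P]_x (cst (n%:R * k)%:E x))//.
  by rewrite integral_cst//= probability_setT mule1.
- move=> x g K mg g_bd.
  apply: (IHn (fun y => g (tcons (x, y))) K) => //.
  apply: (measurableT_comp mg).
  apply: (measurableT_comp (@measurable_tcons _ T n)).
  exact: measurable_pair1.
Qed.

End kullback_leibler.

(** * Translates of a normal law, and coordinates of an i.i.d. sample *)

Section gaussian_model.
Context {R : realType}.
Local Notation RR := (measurableTypeR R).
Local Open Scope ereal_scope.

(* [1 + u <= exp u] is applied to the log-likelihood ratio of the tilted law at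
   [x] and at [- x]: the terms linear in [x] cancel, so that no integrability is
   needed. *)
Lemma normal_shift_log_mgf (s a : R) (g : R -> R) K : s != 0%R ->
  measurable_fun setT g -> (forall x, 0 <= g x <= K)%R ->
  \int[normal_prob 0 s]_x (g (a + x))%:E <=
    (a ^+ 2 / (s ^+ 2 *+ 2) + log_mgf (normal_prob 0 s) g)%:E.
Proof.
move=> s0 mg g_bd; set N := normal_prob 0 s; set c := log_mgf N g.
set r := (a ^+ 2 / (s ^+ 2 *+ 2))%R.
have r0 : (0 <= r)%R by rewrite divr_ge0 ?sqr_ge0// mulrn_wge0 ?sqr_ge0.
have /andP[c0 _] : (0 <= c <= K)%R by exact: log_mgf_itv.
have g0 x : (0 <= g x)%R by case/andP: (g_bd x).
have mE : measurable_fun setT (fun x => (expR (g x))%:E).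
  by apply/measurable_EFinP; exact: measurableT_comp.
have mg1 : measurable_fun setT (fun x : R => g (a + x)%R).
  by apply: (measurableT_comp mg); exact: measurable_funD.
have mg2 : measurable_fun setT (fun x : R => g (a - x)%R).
  by apply: (measurableT_comp mg); exact: measurable_funB.
have mw1 : measurable_fun setT
    (fun x : R => expR (- (a ^+ 2 + 2 * a * x) / (s ^+ 2 *+ 2)))%R.
  apply: measurableT_comp => //; apply: measurable_funM => //.
  apply: measurableT_comp => //; apply: measurable_funD => //.
have mw2 : measurable_fun setT
    (fun x : R => expR (- (a ^+ 2 - 2 * a * x) / (s ^+ 2 *+ 2)))%R.
  apply: measurableT_comp => //; apply: measurable_funM => //.
  apply: measurableT_comp => //; apply: measurable_funB => //.
(* The weights are the ratios of the density at [a + x], respectively [a - x], to the density at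
   [x]. Substitution then gives [E1] and [E2] the same integral as [exp g], namely [expR c]. *)
pose E1 (x : R) := (expR (g (a + x)%R))%:E *
  (expR (- (a ^+ 2 + 2 * a * x) / (s ^+ 2 *+ 2)))%:E.
pose E2 (x : R) := (expR (g (a - x)%R))%:E *
  (expR (- (a ^+ 2 - 2 * a * x) / (s ^+ 2 *+ 2)))%:E.
have IE1 : \int[N]_x E1 x = (expR c)%:E.
  rewrite -(integral_expR_log_mgf N mg g_bd).
  by apply: (ge0_integral_normal_addl s0 a mE) => x; rewrite lee_fin expR_ge0.
have IE2 : \int[N]_x E2 x = (expR c)%:E.
  rewrite -(integral_expR_log_mgf N mg g_bd).
  by apply: (ge0_integral_normal_subl s0 a mE) => x; rewrite lee_fin expR_ge0.
have mE1 : measurable_fun setT E1.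
  by apply: emeasurable_funM; apply/measurable_EFinP => //; exact: measurableT_comp.
have mE2 : measurable_fun setT E2.
  by apply: emeasurable_funM; apply/measurable_EFinP => //; exact: measurableT_comp.
have E10 x : 0 <= E1 x by rewrite /E1 -EFinM lee_fin mulr_ge0// expR_ge0.
have E20 x : 0 <= E2 x by rewrite /E2 -EFinM lee_fin mulr_ge0// expR_ge0.
set I := \int[N]_x (g (a + x)%R)%:E.
have I2 : \int[N]_x (g (a - x)%R)%:E = I.
  rewrite -(ge0_integral_normal_opp s0) => [||x]; last by rewrite lee_fin.
    by apply: eq_integral => x _; rewrite opprK.
  exact/measurable_EFinP.
(* The sum of the two exponential inequalities, with the terms [- c] and [- r] moved to the right so
   that both integrands are nonnegative. *)
have : \int[N]_x (((g (a + x)%R)%:E + (g (a - x)%R)%:E) + 2%:E) <=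
    \int[N]_x ((expR (- c))%:E * (E1 x + E2 x) + (2 * c + 2 * r)%:E).
  apply: ge0_le_integral => //.
  - by move=> x _; rewrite -!EFinD lee_fin !addr_ge0.
  - by apply: emeasurable_funD => //; apply: emeasurable_funD; exact/measurable_EFinP.
  - by apply: emeasurable_funD => //; apply: emeasurable_funM => //; exact: emeasurable_funD.
  - move=> x _; rewrite /E1 /E2 -!EFinM -!EFinD.
    rewrite lee_fin.
    rewrite mulrDr -!expRD.
    set u1 := (- (a ^+ 2 + 2 * a * x) / _)%R.
    set u2 := (- (a ^+ 2 - 2 * a * x) / _)%R.
    have := expR_ge1Dx (- c + (g (a + x) + u1))%R.
    have := expR_ge1Dx (- c + (g (a - x) + u2))%R.
    have : (u1 + u2 = - (2 * r))%R by rewrite /u1 /u2 /r; field.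
    lra.
have cr0 : 0 <= (2 * c + 2 * r)%:E by rewrite lee_fin; lra.
rewrite ge0_integralD//; first last.
- by apply: emeasurable_funD; exact/measurable_EFinP.
- by move=> x _; rewrite -EFinD lee_fin addr_ge0.
rewrite ge0_integralD//; first last.
- exact/measurable_EFinP.
- by move=> x _; rewrite lee_fin.
- exact/measurable_EFinP.
- by move=> x _; rewrite lee_fin.
rewrite ge0_integralD//; first last.
- by apply: emeasurable_funM => //; exact: emeasurable_funD.
- by move=> x _; rewrite mule_ge0// ?lee_fin ?expR_ge0// adde_ge0.
rewrite ge0_integralZl_EFin ?expR_ge0//; first last.
- exact: emeasurable_funD.
- by move=> x _; rewrite adde_ge0.
rewrite ge0_integralD// IE1 IE2 I2 -/I !integral_cst//= !probability_setT !mule1.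
rewrite -!EFinD mulrDr -!expRD addNr expR0.
have : 0 <= I by apply: integral_ge0 => x _; rewrite lee_fin.
case: {I2} I => [i| |] //= _; rewrite -!EFinD !lee_fin; lra.
Qed.

Lemma integral_iid_law_tnth d (T : measurableType d) (P : probability T R) n
    (j : 'I_n) (f : T -> \bar R) :
  measurable_fun setT f -> (forall x, 0 <= f x) ->
  \int[iid_law P n]_x f (tnth x j) = \int[P]_x f x.
Proof.
move=> mf f0; elim: n j => [[]//|n IHn] j.
rewrite ge0_integral_distribution//; last first.
  by apply: (measurableT_comp mf); exact: measurable_tnth.
have [i ->|->] := unliftP ord0 j.
  rewrite (eq_integral (fun z : T * n.-tuple T => f (tnth z.2 i))); last first.
    by move=> z _; rewrite /= tnthS.
  rewrite fubini_tonelli1//; last first.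
    apply: (measurableT_comp mf).
    by apply: (measurableT_comp (measurable_tnth i)).
  rewrite /fubini_F /= -[RHS](IHn i).
  by rewrite (integral_cst P measurableT (\int[iid_law P n]_y f (tnth y i)))/=
    probability_setT mule1.
rewrite (eq_integral (fun z : T * n.-tuple T => f z.1))//.
rewrite fubini_tonelli1//; last by apply: (measurableT_comp mf).
apply: eq_integral => x _; rewrite /fubini_F /=.
by rewrite (integral_cst (iid_law P n) measurableT (f x))/= probability_setT mule1.
Qed.

End gaussian_model.

(** * Fano's inequality for disjoint decision regions and a reference law *)

Section fano.
Context {R : realType} d (T : measurableType d) (M : nat).
Variables (P : 'I_M -> probability T R) (Q : probability T R) (k : R).
Variable A : 'I_M -> set T.
Hypotheses (M_gt0 : (0 < M)%N) (mA : forall i, measurable (A i)).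
Hypotheses (tA : trivIset setT A) (klPQ : forall i, kl_le (P i) Q k).

(** The test function [ln M] times the indicator of [A i] has exponential [1 + (M - 1) * \1_(A i)],
    so the variational bound involves only the probabilities of [A i] under [P i] and [Q]. *)
Lemma kl_le_event i :
  fine (P i (A i)) * ln M%:R <= k + ln (1 + (M%:R - 1) * fine (Q (A i))).
Proof.
pose g x := ln M%:R * \1_(A i) x : R.
have lnM0 : 0 <= ln M%:R :> R by rewrite ln_ge0// ler1n.
have gE x : expR (g x) = 1 + (M%:R - 1) * \1_(A i) x.
  rewrite /g indicE; case: (x \in A i); rewrite ?mulr1 ?mulr0 ?addr0 ?expR0//.
  by rewrite lnK ?posrE ?ltr0n// addrC subrK.
have mI : measurable_fun setT (\1_(A i) : T -> R) by exact: measurable_indic.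
have g_bd x : 0 <= g x <= ln M%:R.
  by rewrite /g indicE; case: (x \in A i); rewrite ?mulr1 ?mulr0 lexx lnM0.
have mg : measurable_fun setT g by apply: measurable_funM.
have := klPQ i mg g_bd.
have -> : (\int[P i]_x (g x)%:E = (fine (P i (A i)) * ln M%:R)%:E)%E.
  transitivity (\int[P i]_x ((ln M%:R)%:E * (\1_(A i) x)%:E))%E.
    by apply: eq_integral => x _; rewrite -EFinM.
  rewrite ge0_integralZl_EFin//; last exact/measurable_EFinP.
  rewrite integral_indic// setIT mulrC EFinM fineK//.
  exact: fin_num_measure.
rewrite lee_fin /log_mgf; congr (_ <= _ + ln _).
transitivity (fine (\int[Q]_x (1 + ((M%:R - 1)%:E * (\1_(A i) x)%:E)))%E).
  by congr fine; apply: eq_integral => x _; rewrite gE -EFinM.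
have M1 : 0 <= M%:R - 1 :> R by rewrite subr_ge0 ler1n.
rewrite ge0_integralD//; first last.
- by apply: emeasurable_funM => //; exact/measurable_EFinP.
- by move=> x _; rewrite -EFinM lee_fin mulr_ge0.
rewrite ge0_integralZl_EFin//; last exact/measurable_EFinP.
rewrite integral_indic// setIT integral_cst//= probability_setT mule1.
have /fineK <- : Q (A i) \is a fin_num by exact: fin_num_measure.
by rewrite -EFinM -EFinD.
Qed.

(** The regions are disjoint, so the [Q (A i)] sum to at most 1 and the average of
    [1 + (M - 1) * Q (A i)] is below 2. Concavity of [ln] bounds the average of the logarithms by
    [ln 2]. *)
Lemma fano :
  (\sum_(i < M) fine (P i (A i))) * ln M%:R <= M%:R * (k + ln 2).
Proof.
(* The tangent of [ln] at 2 takes the place of Jensen's inequality. *)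
have ln_tangent (y : R) : 0 < y -> ln y <= ln 2 + (y / 2 - 1).
  move=> y0; set u := y / 2 - 1; have u1 : -1 < u by rewrite /u; lra.
  have -> : y = 2 * (1 + u) by rewrite /u; field.
  by rewrite lnM ?posrE// ?lerD2l ?le_ln1Dx//; lra.
have M1 : 0 <= M%:R - 1 :> R by rewrite subr_ge0 ler1n.
have Q1 : \sum_(i < M) fine (Q (A i)) <= 1.
  rewrite -lee_fin -sumEFin.
  under eq_bigr do rewrite fineK ?fin_num_measure//.
  rewrite -measure_bigsetU_ord//.
  apply: probability_le1; exact: bigsetU_measurable.
rewrite mulr_suml.
apply: (@le_trans _ _ (\sum_(i < M)
    (k + ln 2 - 1 / 2 + (M%:R - 1) / 2 * fine (Q (A i))))).
  apply: ler_sum => i _; apply: le_trans (kl_le_event i) _.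
  set q := fine _; have q0 : 0 <= q by exact: fine_ge0.
  have := ln_tangent (1 + (M%:R - 1) * q); have : 0 <= (M%:R - 1) * q by exact: mulr_ge0.
  lra.
rewrite big_split/= sumr_const card_ord -mulr_sumr -mulr_natl.
have M1' : 1 <= M%:R :> R by rewrite ler1n.
nra.
Qed.

End fano.

(** * Relative entropy between linear models with isotropic design *)

Section isotropic_design.
Context {R : realType}.
Local Notation RR := (measurableTypeR R).

Lemma cholesky_scalar_mx n (a : R) :
  cholesky (a%:M : 'M[R]_n) = (Num.sqrt a)%:M.
Proof.
elim: n => [|n IHn]; first by rewrite [LHS]flatmx0 [RHS]flatmx0.
rewrite -[n.+1]/(1 + n)%N [cholesky _]/= [X in dlsubmx X]scalar_mx_block.
rewrite block_mxKdl scaler0 mul0mx subr0 [X in drsubmx X]scalar_mx_block.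
have -> : (a%:M : 'M[R]_(1 + n)) 0 0 = a by rewrite mxE eqxx.
by rewrite block_mxKdr IHn -scalar_mx_block.
Qed.

Lemma gaussian_scalar_second_moment d (w : R) (j : 'I_d) : 0 <= w ->
  (\int[gaussian w%:M]_x (tnth x j ^+ 2)%:E <= (2 * w)%:E)%E.
Proof.
move=> w0; rewrite ge0_integral_distribution//; first last.
- by move=> x; rewrite lee_fin sqr_ge0.
- apply/measurable_EFinP; apply: measurable_funX; exact: measurable_tnth.
have mX : measurable_fun setT (fun y : R => (y ^+ 2)%:E).
  by apply/measurable_EFinP; exact: measurable_funX.
pose f (y : R) := (w%:E * (y ^+ 2)%:E)%E.
apply: (@le_trans _ _ (\int[normal_prob (0 : R) 1]_y f y)%E).
  rewrite -(@integral_iid_law_tnth R _ RR (normal_prob (0 : R) 1) d j f); first last.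
  - by move=> y; rewrite /f -EFinM lee_fin mulr_ge0// sqr_ge0.
  - exact: emeasurable_funM.
  rewrite le_eqVlt; apply/orP; left; apply/eqP.
  apply: eq_integral => x _; rewrite /= tnth_mktuple cholesky_scalar_mx.
  by rewrite mul_scalar_mx !mxE exprMn sqr_sqrtr// EFinM.
rewrite ge0_integralZl_EFin//; last by move=> x _; rewrite lee_fin sqr_ge0.
by rewrite mulrC EFinM lee_wpmul2l ?lee_fin// normal_second_moment_le2.
Qed.

(** The designs have the same law and contribute 0. Given the design [x], the responses are normal
    with means [b * x_j] apart, which costs [b ^+ 2 * x_j ^+ 2 / (2 * sigma2)]; the second moment of
    [x_j] is bounded by [2 * w]. *)
Lemma kl_le_linear_model d (beta beta' : 'cV[R]_d) (w b sigma2 : R) (j : 'I_d) :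
  0 <= w -> 0 < sigma2 -> beta = beta' + b *: delta_mx j 0 ->
  kl_le (linear_model_law beta w%:M sigma2) (linear_model_law beta' w%:M sigma2)
    (b ^+ 2 * w / sigma2).
Proof.
move=> w0 s0 betaE; rewrite -[_ / _]add0r.
pose k (x : d.-tuple RR) := b ^+ 2 / (sigma2 *+ 2) * (tnth x j : R) ^+ 2.
have k0 x : 0 <= k x.
  by rewrite mulr_ge0 ?sqr_ge0// divr_ge0 ?sqr_ge0// mulrn_wge0// ltW.
have mt : measurable_fun setT (fun x : d.-tuple RR => (tnth x j : R) ^+ 2).
  apply: measurable_funX; exact: measurable_tnth.
apply: (kl_le_chain (k := k)) => //.
- exact: kl_le_refl.
- exact: measurable_funM.
- rewrite (eq_integral (fun x : d.-tuple RR =>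
    ((b ^+ 2 / (sigma2 *+ 2))%:E * ((tnth x j : R) ^+ 2)%:E)%E)); last first.
    by move=> x _; rewrite -EFinM.
  rewrite ge0_integralZl_EFin//; last 3 first.
  + by move=> x _; rewrite lee_fin sqr_ge0.
  + exact/measurable_EFinP.
  + by rewrite divr_ge0 ?sqr_ge0// mulrn_wge0// ltW.
  apply: (@le_trans _ _ ((b ^+ 2 / (sigma2 *+ 2))%:E * (2 * w)%:E)%E).
    apply: lee_wpmul2l.
      by rewrite lee_fin divr_ge0 ?sqr_ge0// mulrn_wge0// ltW.
    exact: gaussian_scalar_second_moment.
  rewrite -EFinM lee_fin le_eqVlt; apply/orP; left; apply/eqP; field.
  by rewrite gt_eqF.
- move=> x g K mg g_bd /=.
  pose t := ((vec_of_tuple x)^T *m beta') 0 0.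
  pose f (u : R) := g (x, t + u).
  have sq0 : Num.sqrt sigma2 != 0 by rewrite gt_eqF ?sqrtr_gt0.
  have mf : measurable_fun setT f.
    apply: (measurableT_comp mg); apply/measurable_fun_pair => //=.
    exact: measurable_funD.
  have f_bd u : 0 <= f u <= K by exact: g_bd.
  have := normal_shift_log_mgf (b * tnth x j) sq0 mf f_bd.
  rewrite sqr_sqrtr => [H|]; last exact: ltW.
  apply: etrans H; congr (_ <= _)%E.
    apply: eq_integral => u _; rewrite /f /response /= betaE mulmxDr mxE.
    rewrite -/t -scalemxAr mxE; congr (g (_, _))%:E; rewrite -addrA; congr (_ + (_ * _ + _)).
    by rewrite -colE !mxE.
  by congr (_ + _)%:E; rewrite /k exprMn mulrAC.
Qed.

End isotropic_design.

(** * Scalar covariance matrices belong to the class *)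

Section scalar_covariance.
Context {R : realType}.

Lemma posdef_scalar_mx d (w : R) : 0 < w -> posdef (w%:M : 'M[R]_d).
Proof.
move=> w0; split=> [|x x0]; first exact: tr_scalar_mx.
rewrite mul_mx_scalar -scalemxAl mxE mulr_gt0// mxE.
have [i xi] : exists i, x i 0 != 0.
  apply/existsP; apply: contra_neqT x0 => /existsPn x0.
  by apply/matrixP => i j; rewrite ord1 mxE; apply/eqP; rewrite -[_ == _]negbK x0.
rewrite (bigD1 i)//= mxE ltr_pwDl//.
  by rewrite lt_def mulf_neq0//= -expr2 sqr_ge0.
by apply: sumr_ge0 => k _; rewrite mxE -expr2 sqr_ge0.
Qed.

Lemma lambda_min_scalar_mx n (w : R) : (0 < n)%N ->
  lambda_min (w%:M : 'M[R]_n) = w.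
Proof.
case: n => // n _; rewrite /lambda_min (_ : [set a | _] = [set w]) ?inf1//.
apply/seteqP; split => [a /eigenvalueP[v]|_ ->] /=.
  rewrite mul_mx_scalar => /eqP; rewrite -subr_eq0 -scalerBl scaler_eq0.
  by move=> /orP[|->//]; rewrite subr_eq0 => /eqP->.
apply/eigenvalueP; exists (const_mx 1); first by rewrite mul_mx_scalar.
by apply/eqP => /matrixP/(_ 0 0)/eqP; rewrite !mxE oner_eq0.
Qed.

Lemma cond_cov_scalar_mx d (w : R) (S T : {set 'I_d}) :
  cond_cov (w%:M) S T = w%:M.
Proof.
(* The cross-covariance block vanishes because [S :\: T] and [T] are disjoint. *)
rewrite /cond_cov (_ : Defs.submx _ T _ = 0) ?mul0mx ?subr0; last first.
  apply/matrixP => i j; rewrite !mxE; case: eqP => // ij.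
  have := enum_valP i; have := enum_valP j.
  by rewrite ij inE => ->.
by apply/matrixP => i j; rewrite !mxE (inj_eq enum_val_inj).
Qed.

Lemma Omega_scalar_mx d s (w : R) : 0 < w -> Omega s w (w%:M : 'M[R]_d).
Proof.
move=> w0; split=> [|S T cS cT ST]; first exact: posdef_scalar_mx.
rewrite cond_cov_scalar_mx lambda_min_scalar_mx//.
(* The block has positive size: if [S :\: T] were empty, [S] would be contained in [T], hence equal
   to it by cardinality. *)
rewrite card_gt0; apply: contraNneq ST => /eqP; rewrite finset.setD_eq0 => sST.
by rewrite eqEcard sST cS cT leqnn.
Qed.

End scalar_covariance.

(** * The family of signals with one free coordinate *)

Section one_free_coordinate.
Context {R : realType} (r m : nat) (b : R).
Hypothesis b0 : 0 < b.

(** With only [r] nonzero entries it lies outside [Theta r.+1 b]; it provides the reference law in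
    Fano's inequality. *)
Definition base_signal : 'cV[R]_(r + m) := col_mx (const_mx b) 0.

Definition signal (k : 'I_m) : 'cV[R]_(r + m) :=
  base_signal + b *: delta_mx (rshift r k) 0.

Lemma signalE k i :
  signal k i 0 = if i \in rshift r k |: (lshift m @: [set: 'I_r])%SET then b else 0.
Proof.
rewrite /signal !mxE !inE; case: splitP => j ij; rewrite !mxE.
  have -> : i = lshift m j by exact: val_inj.
  by rewrite eq_lrshift imset_f ?inE// orbT/= mulr0 addr0.
have -> : i = rshift r j by exact: val_inj.
rewrite add0r eq_rshift eqxx andbT.
rewrite [_ \in _](_ : _ = false) ?orbF; first by case: eqP; rewrite ?mulr1 ?mulr0.
by apply/imsetP => -[l _] /eqP; rewrite eq_rlshift.
Qed.

Lemma supp_signal k : supp (signal k) = (rshift r k |: (lshift m @: [set: 'I_r]))%SET.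
Proof.
by apply/setP => i; rewrite inE signalE; case: ifP; rewrite ?eqxx ?gt_eqF.
Qed.

Lemma supp_signal_inj : injective (fun k => supp (signal k)).
Proof.
move=> k l /setP/(_ (rshift r k)); rewrite !supp_signal !inE eqxx eq_rshift.
move=> /esym/orP[/eqP//|/imsetP[j _] /eqP]; by rewrite eq_rlshift.
Qed.

Lemma Theta_signal k : Theta r.+1 b (signal k).
Proof.
split=> [|j].
  rewrite supp_signal cardsU1 card_imset; last exact: lshift_inj.
  rewrite cardsT card_ord; case: imsetP => // -[j _] /eqP.
  by rewrite eq_rlshift.
by rewrite supp_signal signalE => ->; exact: ler_norm.
Qed.

End one_free_coordinate.

(** * The maximum over [l] in the sample size bound *)

Lemma leq_bin_expn m l : ('C(m, l) <= m ^ l)%N.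
Proof.
apply: leq_trans (_ : m ^_ l <= _)%N.
  by rewrite -bin_ffact leq_pmulr// fact_gt0.
elim: l => // l IHl.
by rewrite ffactnSr expnSr leq_mul// leq_subr.
Qed.

(** In [ln 'C(m, l) <= l * ln m] the factor [l] cancels the one in the denominator, so every term is
    at most the term at [l = 1]. *)
Lemma max_termE {R : realType} d s (b w s2 : R) :
  (0 < s)%N -> (2 * s <= d)%N -> 0 < b -> 0 < w -> 0 < s2 ->
  max_term d s b w s2 = ln (d - s)%:R / (b ^+ 2 * w / s2).
Proof.
move=> s0 sd b0 w0 s20; set m := (d - s)%N.
have sm : (s <= m)%N by rewrite /m; lia.
have m0 : (0 < m)%N by lia.
have F0 : 0 < b ^+ 2 * w / s2 by rewrite divr_gt0// mulr_gt0// exprn_gt0.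
have lm0 : 0 <= ln m%:R :> R by rewrite ln_ge0// ler1n.
apply/le_anti/andP; split.
  rewrite /max_term big_nat_cond; apply: bigmax_le => [|l].
    by rewrite divr_ge0// ltW.
  rewrite andbT => /andP[l0 ls]; have l0R : 0 < l%:R :> R by rewrite ltr0n.
  have lnC : ln 'C(m, l)%:R <= l%:R * ln m%:R :> R.
    rewrite mulr_natl -lnXn ?ltr0n// ler_ln ?posrE ?exprn_gt0 ?ltr0n ?bin_gt0//; last by lia.
    by rewrite -natrX ler_nat leq_bin_expn.
  have -> : l%:R * b ^+ 2 * w / s2 = l%:R * (b ^+ 2 * w / s2) by rewrite !mulrA.
  rewrite -/m ler_pdivrMr ?(mulr_gt0 l0R F0)//; apply: le_trans lnC _.
  by rewrite mulrCA divfK ?gt_eqF.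
rewrite /max_term big_ltn// le_max; apply/orP; left.
by rewrite bin1 mul1r.
Qed.

(** * From Fano's inequality to the minimax risk *)

Section lower_bound.
Context {R : realType}.

Lemma error_prob_success n d (Shat : samples n d -> {set 'I_d}) (m : @model R d) :
  estimator Shat ->
  error_prob Shat m =
    (1 - iid_law (linear_model_law m.1.1 m.1.2 m.2) n
           (Shat @^-1` [set` [set supp m.1.1]%SET]))%E.
Proof.
move=> mS; rewrite -probability_setC; last exact: mS.
congr (iid_law _ _ _); apply/seteqP; split => z /=; rewrite inE => /negP; exact.
Qed.

(** The decision regions are the events that [Shat] returns the support of the [k]-th signal; they
    are disjoint since the supports differ. Each has probability above [1 - x] under its own law,
    and Fano's inequality applies. *)
Lemma minimax_error_lower_bound n r M (b w s2 x : R)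
    (Shat : samples n (r + M) -> {set 'I_(r + M)}) :
  0 < b -> 0 < w -> 0 < s2 -> (0 < M)%N -> estimator Shat ->
  (forall k : 'I_M, (error_prob Shat (signal r b k, w%:M, s2) < x%:E)%E) ->
  (1 - x) * ln M%:R <= n%:R * (b ^+ 2 * w / s2) + ln 2.
Proof.
move=> b0 w0 s20 M0 mS err.
pose A (k : 'I_M) := Shat @^-1` [set` [set supp (signal r b k)]%SET].
pose P (k : 'I_M) := iid_law (linear_model_law (signal r b k) w%:M s2) n.
have mA k : measurable (A k) by exact: mS.
have tA : trivIset setT A.
  move=> k l _ _ [z []]; rewrite /A /= !inE => /eqP zk /eqP zl.
  by apply: (@supp_signal_inj R r M b b0); rewrite -zk -zl.
have klP k : kl_le (P k) (iid_law (linear_model_law (base_signal r M b) w%:M s2) n)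
    (n%:R * (b ^+ 2 * w / s2)).
  by apply: kl_le_iid; apply: (kl_le_linear_model (j := rshift r k)) => //; exact: ltW.
have M0R : 0 < M%:R :> R by rewrite ltr0n.
rewrite -(ler_pM2l M0R); apply: le_trans (fano M0 mA tA klP); rewrite mulrA ler_wpM2r//.
  by rewrite ln_ge0// ler1n.
have -> : M%:R * (1 - x) = \sum_(k < M) (1 - x).
  by rewrite sumr_const card_ord mulr_natl.
apply: ler_sum => k _.
have := err k; rewrite error_prob_success//= -/(A k) -/(P k).
have /fineK <- : P k (A k) \is a fin_num by exact: fin_num_measure.
rewrite -EFinB lte_fin; lra.
Qed.

End lower_bound.

Theorem theorem3p3 (R : realType) :
  exists c C : R, 0 < c /\ 0 < C /\
  forall (d s : nat) (beta_min sigma2 omega delta : R),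
    (0 < d)%N -> (0 < s)%N -> (2 * s <= d)%N -> (2 <= 'C(d - s, s))%N ->
    0 < beta_min -> 0 < sigma2 -> 0 < omega < 1 -> 0 < delta < 1 / 2 ->
    let bound := (1 - 2 * delta) / 2 * max_term d s beta_min omega sigma2 in
    let rate := (1 - 2 * delta) / 2 *
      (ln ((d - s)%:R) / (beta_min ^+ 2 * omega / sigma2)) in
    (c * rate <= bound <= C * rate) /\
    forall n : nat, n%:R <= bound ->
      ((delta - ln 2 / ln ('C(d - s, s)%:R))%:E
        <= minimax_risk n (@model_class R d s beta_min omega sigma2))%E.
Proof.
(* Both constants are 1 because the two rates are equal by [max_termE]. *)
exists 1, 1; split=> //; split=> // d s b s2 w delta d0 s0 sd C2 b0 s20
  /andP[w0 _] /andP[dl0 dl1] bound rate.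
have boundE : bound = rate by rewrite /bound max_termE.
split=> [|n]; first by rewrite boundE mul1r lexx.
rewrite boundE {bound boundE} => n_le.
set x := delta - _.
have lnC0 : 0 < ln 'C(d - s, s)%:R :> R by rewrite ln_gt0// ltr1n.
have ln20 : 0 < ln 2 :> R by rewrite ln_gt0// ltr1n.
have x_delta : x < delta by rewrite ltrBlDr ltrDl divr_gt0.
(* [r = s - 1] coordinates are fixed and [M = d - s + 1] positions remain for the last one, so that
   [d - s] becomes [M.-1]. *)
have [r [M [dE sE M1]]] : exists r M, [/\ d = (r + M)%N, s = r.+1 & (1 < M)%N].
  by exists s.-1, (d - s).+1; split; move: s0 sd; clear; lia.
subst d s; have mE : (r + M - r.+1 = M.-1)%N by lia.
rewrite /minimax_risk; apply: le_ereal_inf_tmp => _ [Shat mS <-].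
rewrite leNgt; apply/negP => lt_x.
have err k : (error_prob Shat (signal r b k, w%:M, s2) < x%:E)%E.
  apply: le_lt_trans lt_x; apply: ereal_sup_ubound.
  exists (signal r b k, w%:M, s2) => //; split => //=; first exact: Theta_signal.
  exact: Omega_scalar_mx.
have M0 : (0 < M)%N by exact: ltnW.
(* An error probability lies below [x], so the claimed bound is positive; this excludes the small
   values of [M] below. *)
have x0 : 0 < x.
  rewrite -lte_fin; apply: le_lt_trans (err (Ordinal M0)).
  exact: measure_ge0.
have main := minimax_error_lower_bound b0 w0 s20 M0 mS err.
have F0 : 0 < b ^+ 2 * w / s2 by rewrite divr_gt0// mulr_gt0// exprn_gt0.
have {n_le} n_le : n%:R * (b ^+ 2 * w / s2) <= (1 - 2 * delta) / 2 * ln (M.-1)%:R.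
  by rewrite -ler_pdivlMr// -mE -[leRHS]mulrA.
(* For [M <= 3] the binomial coefficient, at least 2 by assumption, can only be ['C(2, 1) = 2]. Then
   [x = delta - 1] is negative. The resulting [M >= 4] gives [ln 2 <= ln M / 2]. *)
have M3 : (3 < M)%N.
  rewrite ltnNge; apply/negP => M3.
  have m2 : M.-1 = 2%N \/ M.-1 = 1%N by move: M1 M3; clear; lia.
  have C_eq2 : 'C(M.-1, r.+1) = 2%N.
    move: C2; rewrite mE; case: m2 => ->; last by case: (r).
    by case: (r) => [|[|?]].
  by move: x0; rewrite /x mE C_eq2 divff ?gt_eqF//; lra.
have lnM4 : 2 * ln 2 <= ln M%:R :> R.
  rewrite mulr_natl -lnXn// -natrX ler_ln ?posrE ?ltr0n ?expn_gt0//.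
  by rewrite ler_nat.
have lnM1 : ln (M.-1)%:R <= ln M%:R :> R.
  by rewrite ler_ln ?posrE ?ltr0n ?ler_nat ?leq_pred//; move: M1; clear; lia.
have L0 : 0 < ln M%:R :> R by lra.
have n_leL : (1 - 2 * delta) / 2 * ln (M.-1)%:R <= (1 - 2 * delta) / 2 * ln M%:R.
  by rewrite ler_wpM2l//; lra.
have x_deltaL : (1 - delta) * ln M%:R < (1 - x) * ln M%:R by rewrite ltr_pM2r//; lra.
set L := ln M%:R in L0 lnM4 main n_leL x_deltaL.
(* Fano now gives [(1 - x) * L <= (1 - delta) * L - L / 2 + ln 2], which is at most
   [(1 - delta) * L] and contradicts [x < delta]. *)
have half : (1 - 2 * delta) / 2 * L = (1 - delta) * L - L / 2 by field.
move: ((1 - x) * L) ((1 - delta) * L) (n%:R * _) n_le main x_deltaL n_leL half.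
move=> u v t; lra.
Qed.
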